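(* Let $\mathcal{P}$ be a collection of probability distributions on $\mathcal{Z}^{n+1}$, let $\alpha>0$, let $P_*^{Z^n}$ be a probability distribution on $\mathcal{Z}^n$, and let $\mu^{|Z^n}$ be a probability kernel from $\mathcal{Z}^n$ to $\mathcal{Z}$. Then a prediction set $C_\alpha$ that is valid at level $\alpha$ for $\mathcal{P}$ minimizes $$\mathrm{E}^{P_*^{Z^n}}\left[\mu^{|Z^n}(C_\alpha^{Z^n})\right]$$ over all prediction sets that are valid at level $\alpha$ for $\mathcal{P}$ if and only if the corresponding test $C_\alpha$ is most powerful against the alternative $Q=P_*^{Z^n}\otimes\mu^{|Z^n}$.
   Context: $\mathcal{Z}$ is a measurable sample space and $Z^{n+1}=(Z^n,Z_{n+1})$ denotes a random element of $\mathcal{Z}^{n+1}$. A prediction set $C_\alpha$ is a (measurable) subset of $\mathcal{Z}^{n+1}$ with slices $C_\alpha^{z^n}=\{z\in\mathcal{Z}:(z^n,z)\in C_\alpha\}$; it is valid at level $\alpha$ for $\mathcal{P}$ if $P(Z_{n+1}\in C_\alpha^{Z^n})\ge 1-\alpha$ for every $P\in\mathcal{P}$. The same symbol $C_\alpha$ denotes the corresponding test $\mathcal{Z}^{n+1}\to\{0,1\}$, which equals $1$ (rejection) at $z^{n+1}$ if $z_{n+1}\notin C_\alpha^{z^n}$ and $0$ otherwise; the test is valid at level $\alpha$ if $\mathrm{E}^P[C_\alpha]\le\alpha$ for every $P\in\mathcal{P}$. The test is most powerful against $Q$ if it maximizes $\mathrm{E}^Q[C_\alpha]$ over all $\{0,1\}$-valued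 tests that are valid at level $\alpha$ for $\mathcal{P}$. $P_*^{Z^n}\otimes\mu^{|Z^n}$ denotes the joint distribution on $\mathcal{Z}^{n+1}$ under which $Z^n\sim P_*^{Z^n}$ and $Z_{n+1}$ given $Z^n$ has distribution $\mu^{|Z^n}$. *)

(* Defs.v *)
From HB Require Import structures.
From mathcomp Require Import all_boot all_order all_algebra.
From mathcomp Require Import all_classical all_reals all_analysis.

Set Implicit Arguments.
Unset Strict Implicit.
Unset Printing Implicit Defensive.

Import Order.TTheory GRing.Theory Num.Theory.
Import numFieldNormedType.Exports.

Local Open Scope classical_set_scope.
Local Open Scope ring_scope.

(* The distribution of (X, Y) when X ~ P and Y given X = x has law k x. It is
   the product of kernels of the library, with P seen as a kernel from the
   one-point space. *)
Section joint.
Context d1 d2 (T1 : measurableType d1) (T2 : measurableType d2) (R : realType)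
  (P : probability T1 R) (k : R.-pker T1 ~> T2).
Local Open Scope ereal_scope.

Definition joint : set (T1 * T2) -> \bar R :=
  kproduct_snd (fun=> P : {measure set T1 -> \bar R}) k tt.

Let k1 := kprobability
  (@measurable_cst _ _ unit (pprobability T1 R) setT (P : pprobability T1 R)).

Let jointE : joint = mkproduct k1 (kernel.kernel_snd k) tt.
Proof. by []. Qed.

Let joint0 : joint set0 = 0.
Proof. by rewrite jointE measure0. Qed.

Let joint_ge0 A : 0 <= joint A.
Proof. by rewrite jointE measure_ge0. Qed.

Let joint_sigma_additive : semi_sigma_additive joint.
Proof. by rewrite jointE; exact: measure_semi_sigma_additive. Qed.

HB.instance Definition _ := isMeasure.Build _ _ _ joint
  joint0 joint_ge0 joint_sigma_additive.

Let joint_setT : joint setT = 1.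
Proof.
transitivity (\int[P]_x cst 1 x).
  apply: eq_integral => x _; rewrite /kernel.intker_indic /=.
  under eq_integral do rewrite indicT.
  by rewrite (integral_cst _ _ 1)// mul1e prob_kernel.
by rewrite (integral_cst _ _ 1)// mul1e; exact: probability_setT.
Qed.

HB.instance Definition _ :=
  Measure_isProbability.Build _ _ _ joint joint_setT.

End joint.

(* Z^(n+1) is represented as Z^n * Z, in accordance with the splitting
   Z^(n+1) = (Z^n, Z_(n+1)). *)
Notation sample Z n := (n.-tuple Z * Z)%type.

Section prediction.
Context d (Z : measurableType d) (n : nat) (R : realType).
Implicit Types (PP : set (probability (sample Z n) R)) (alpha : R).
Local Open Scope ereal_scope.

Definition valid_set PP alpha (C : set (sample Z n)) :=
  measurable C /\
  forall P, PP P -> (1 - alpha)%:E <= P [set z | z.2 \in xsection C z.1].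

Definition test_of (C : set (sample Z n)) : sample Z n -> bool :=
  fun z => z.2 \notin xsection C z.1.

Definition rejection (P : probability (sample Z n) R)
    (phi : sample Z n -> bool) : \bar R :=
  'E_P[fun z => (phi z)%:R].

Definition valid_test PP alpha (phi : sample Z n -> bool) :=
  measurable_fun [set: sample Z n] phi /\
  forall P, PP P -> rejection P phi <= alpha%:E.

Definition most_powerful PP alpha (Q : probability (sample Z n) R)
    (phi : sample Z n -> bool) :=
  valid_test PP alpha phi /\
  forall psi, valid_test PP alpha psi -> rejection Q psi <= rejection Q phi.

Definition expected_size (Pstar : probability (n.-tuple Z) R)
    (mu : R.-pker (n.-tuple Z) ~> Z) (C : set (sample Z n)) : \bar R :=
  \int[Pstar]_zn mu zn (xsection C zn).

Definition minimizes_expected_size PP alpha Pstar mu (C : set (sample Z n)) :=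
  valid_set PP alpha C /\
  forall D, valid_set PP alpha D ->
    expected_size Pstar mu C <= expected_size Pstar mu D.

End prediction.

(* Main.v *)
(* A test rejects exactly on the complement of its prediction set, so for every
   probability P the rejection probability is 1 - P C. Hence prediction sets
   and tests correspond to each other with the same notion of validity, and,
   as E^{Pstar}[mu(C^{Z^n})] = (Pstar (x) mu)(C), minimizing the expected size
   is maximizing the power against Pstar (x) mu. *)
Require Import Defs.
From mathcomp Require Import all_boot all_order all_algebra.
From mathcomp Require Import all_classical all_reals all_analysis.

Import GRing.Theory Num.Theory.

Local Open Scope classical_set_scope.
Local Open Scope ring_scope.

(** The kernel product is an iterated integral of the indicator of [A]; for fixed [x] the inner
    integrand is the indicator of the section of [A] at [x], so it integrates to the [k x]-mass of
    that section. *)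
Lemma joint_xsection d1 d2 (T1 : measurableType d1) (T2 : measurableType d2)
    (R : realType) (P : probability T1 R) (k : R.-pker T1 ~> T2)
    (A : set (T1 * T2)) :
  measurable A -> joint P k A = (\int[P]_x k x (xsection A x))%E.
Proof.
move=> mA; rewrite /joint /kproduct_snd /kproduct.
apply: eq_integral => x _; rewrite /kernel.intker_indic /=.
have mAx : measurable [set y | A (x, y)].
  by rewrite -[X in measurable X]xsectionE; exact: measurable_xsection.
by rewrite (@integral_indic _ _ _ (k x) _ measurableT _ mAx) setIT xsectionE.
Qed.

Section sets_and_tests.
Context d (Z : measurableType d) (n : nat) (R : realType).
Implicit Types (P : probability (sample Z n) R) (C : set (sample Z n))
  (psi : sample Z n -> bool).

Lemma test_ofE C : test_of C = fun z => z \notin C.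
Proof. by apply/funext => -[x y]; rewrite /test_of mem_xsection. Qed.

Lemma prediction_setE C : [set z | z.2 \in xsection C z.1] = C.
Proof.
by apply/seteqP; split=> -[x y] /=; rewrite mem_xsection ?inE.
Qed.

(** Lets optimality over sets speak about arbitrary tests: each one arises from its acceptance
    region. *)
Lemma test_of_accept psi : test_of (psi @^-1` [set false]) = psi.
Proof.
rewrite test_ofE; apply/funext => z; apply/idP/idP => [|pz].
  by rewrite notin_setE /=; case: (psi z).
by rewrite notin_setE /= pz.
Qed.

Lemma measurable_test_of C :
  measurable C -> measurable_fun setT (test_of C).
Proof.
(* For a boolean function it is enough to measure the preimage of [true], here the complement of
   [C]. *)
move=> mC; apply: (measurable_fun_bool true); rewrite setTI test_ofE.
rewrite [X in measurable X](_ : _ = ~` C); first exact: measurableC.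
by apply/seteqP; split=> z /=; rewrite -notin_setE.
Qed.

Lemma rejection_test_of P C :
  measurable C -> rejection P (test_of C) = (1 - P C)%E.
Proof.
move=> mC; rewrite -probability_setC// -expectation_indic; last first.
  exact: measurableC.
by congr expectation; rewrite test_ofE;
  apply/funext => z; rewrite indicE in_setC.
Qed.

Lemma valid_test_of (PP : set (probability (sample Z n) R)) (alpha : R) C :
  measurable C -> valid_test PP alpha (test_of C) <-> valid_set PP alpha C.
Proof.
move=> mC.
have eqP P : (rejection P (test_of C) <= alpha%:E)%E =
    ((1 - alpha)%:E <= P [set z | z.2 \in xsection C z.1])%E.
  (* [P C] is finite, so the inequality can be rearranged in [R]. *)
  rewrite prediction_setE rejection_test_of// -(fineK (fin_num_measure P C mC)).
  by rewrite -EFinB !lee_fin !lerBlDr addrC.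
split=> -[_ valid]; split.
- exact: mC.
- by move=> P /valid; rewrite eqP.
- exact: measurable_test_of.
- by move=> P /valid; rewrite eqP.
Qed.

(** The map p to 1 - p reverses the order on finite values. *)
Lemma le_rejection_test_of P C D : measurable C -> measurable D ->
  (rejection P (test_of D) <= rejection P (test_of C))%E = (P C <= P D)%E.
Proof.
move=> mC mD; rewrite !rejection_test_of//.
rewrite -(fineK (fin_num_measure P C mC)) -(fineK (fin_num_measure P D mD)).
by rewrite -!EFinB !lee_fin lerD2l lerN2.
Qed.

End sets_and_tests.

Theorem theorem2 (R : realType) (d : measure_display) (Z : measurableType d)
    (n : nat) (PP : set (probability (sample Z n) R)) (alpha : R)
    (Pstar : probability (n.-tuple Z) R) (mu : R.-pker (n.-tuple Z) ~> Z)
    (C : set (sample Z n)) :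
  0 < alpha -> valid_set PP alpha C ->
  minimizes_expected_size PP alpha Pstar mu C <->
  most_powerful PP alpha (joint Pstar mu) (test_of C).
Proof.
move=> _ vC; have mC := vC.1.
have sizeE D : measurable D -> expected_size Pstar mu D = joint Pstar mu D.
  by move=> mD; rewrite joint_xsection.
split=> -[_ optC]; split.
- exact/valid_test_of.
- move=> psi vpsi.
  (* The acceptance region of [psi] serves as the competing prediction set. *)
  have mD : measurable (psi @^-1` [set false]).
    by rewrite -[X in measurable X]setTI; exact: vpsi.1.
  move: vpsi; rewrite -(test_of_accept _ _ _ psi)
    => /(valid_test_of _ _ _ _ _ _ _ mD) vD.
  rewrite le_rejection_test_of//.
  by have := optC _ vD; rewrite !sizeE.
- exact: vC.
- move=> D vD; have mD := vD.1; rewrite !sizeE//.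
  (* Conversely, the test of [D] serves as the competitor. *)
  have := optC _ ((valid_test_of _ _ _ _ _ _ _ mD).2 vD).
  by rewrite le_rejection_test_of.
Qed.
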